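(* Let $(E,G)$ be a Riemannian Lie algebroid over $M$. A section $u \in \mathrm{Sec}(E)$ is a Killing section if and only if $$\{u, \mathcal{H}\}_{E} = 0,$$ where $u$ is regarded as a fibrewise linear function on $E^{*}$, $\mathcal{H}\in C^\infty(E^* )$ is the energy of $(E,G)$, and $\{\cdot,\cdot\}_E$ is the linear Poisson bracket on $C^\infty(E^* )$ defined by the Lie algebroid structure.
   Context: A Lie algebroid is a vector bundle $E\to M$ with a Lie bracket $[\cdot,\cdot]$ on its space of smooth sections $\mathrm{Sec}(E)$ and an anchor $\rho:\mathrm{Sec}(E)\to\mathrm{Vect}(M)$ (induced by a vector bundle map $E\to TM$) such that $[u,fv]=\rho(u)[f]\,v+f[u,v]$ for all $u,v\in \mathrm{Sec}(E)$, $f\in C^\infty(M)$. With local coordinates $x^A$ on $M$ and a local basis of sections $(s_a)$, the structure functions are given by $[s_a,s_b]=Q_{ab}^c(x)s_c$ and $\rho(s_a)=Q_a^A(x)\frac{\partial}{\partial x^A}$. Let $(x^A,y^a)$ be the induced coordinates on $E$ and $(x^A,\pi_a)$ the dual coordinates on $E^*$. Repeated indices are summed. A Riemannian metric on $E$ is a smooth assignment of an inner product to each fibre, $\langle u|v\rangle=G_{ab}(x)u^av^b$, with no compatibility with the Lie algebroid structure required; $(E,G)$ is then called a Riemannian Lie algebroid. The metric is also regarded as the quadratic function $G=y^ay^bG_{ba}$ on $E$. The matrix $G^{ab}$ is the inverse of $G_{ab}$. The tangent lift of $u=u^as_a\in \mathrm{Sec}(E)$ is the vector field on $E$ $$d_T(u)=u^aQ_a^A\frac{\partial}{\partial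 x^A}+\left(y^aQ_a^A\frac{\partial u^c}{\partial x^A}-y^au^bQ_{ba}^c\right)\frac{\partial}{\partial y^c}.$$ The section $u$ is a Killing section of $(E,G)$ if $\mathcal{L}_uG:=d_T(u)[G]=0$. The Poisson bracket on $C^\infty(E^* )$ is $$\{F,H\}_E=Q_a^A\left(\frac{\partial F}{\partial\pi_a}\frac{\partial H}{\partial x^A}-\frac{\partial F}{\partial x^A}\frac{\partial H}{\partial\pi_a}\right)-Q_{ba}^c\pi_c\frac{\partial F}{\partial\pi_a}\frac{\partial H}{\partial\pi_b}.$$ The energy is $\mathcal{H}(x,\pi)=\frac12G^{ab}(x)\pi_b\pi_a$. A section $u=u^a(x)s_a$ is identified with the fibrewise linear function $u^a(x)\pi_a$ on $E^*$. *)

(* Defs.v *)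
(* Smooth manifolds, vector bundles and Riemannian Lie algebroids on top of
   MathComp and MathComp-Analysis.  Manifolds are smooth, Hausdorff, second
   countable and without boundary. *)
From mathcomp Require Import all_boot all_order all_algebra.
From mathcomp Require Import all_classical all_reals all_analysis.

Set Implicit Arguments.
Unset Strict Implicit.
Unset Printing Implicit Defensive.

Import Order.TTheory GRing.Theory Num.Theory.
Import numFieldNormedType.Exports.

Local Open Scope classical_set_scope.
Local Open Scope ring_scope.

Section smoothness.
Context {R : realType} {n : nat}.
Implicit Types (U : set 'rV[R]_n) (f : 'rV[R]_n -> R).

Definition partial (i : 'I_n) f (x : 'rV[R]_n) : R := 'D_(delta_mx 0 i) f x.

(* Only meant for open U: derivatives and continuity are those of f on 'rV_n,
   not of its restriction to U. *)
Fixpoint class_C (k : nat) U f : Prop :=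
  match k with
  | 0 => forall x, U x -> {for x, continuous f}
  | k'.+1 => (forall x, U x -> differentiable f x) /\
             (forall i, class_C k' U (partial i f))
  end.

Definition smooth_on U f := forall k, class_C k U f.

End smoothness.

(* chart_inv is the inverse of chart_map on chart_map @` chart_dom; the values
   of the two maps elsewhere are irrelevant. *)
Record chart (R : realType) (n : nat) (M : topologicalType) := Chart {
  chart_dom : set M ;
  chart_map :> M -> 'rV[R]_n ;
  chart_inv : 'rV[R]_n -> M ;
  chart_dom_open : open chart_dom ;
  chart_img_open : open (chart_map @` chart_dom) ;
  chart_mapK : forall p, chart_dom p -> chart_inv (chart_map p) = p ;
  chart_map_continuous :
    forall p, chart_dom p -> {for p, continuous chart_map} ;
  chart_inv_continuous :
    forall x, (chart_map @` chart_dom) x -> {for x, continuous chart_inv} }.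

Definition chart_coord (R : realType) (n : nat) (M : topologicalType)
  (phi : chart R n M) (i : 'I_n) (p : M) : R := phi p 0 i.

Record manifold (R : realType) (n : nat) := Manifold {
  carrier :> topologicalType ;
  atlas : set (chart R n carrier) ;
  carrier_hausdorff : hausdorff_space carrier ;
  carrier_second_countable : @second_countable carrier ;
  atlas_cover : forall p, exists2 phi, atlas phi & chart_dom phi p ;
  atlas_smooth : forall phi psi, atlas phi -> atlas psi -> forall i,
    smooth_on (phi @` (chart_dom phi `&` chart_dom psi))
              (chart_coord psi i \o chart_inv phi) }.

Section manifold_theory.
Context {R : realType} {n : nat} (M : manifold R n).
Implicit Types (W : set M) (f : M -> R).

Definition msmooth_on W f := forall phi, atlas phi ->
  smooth_on (phi @` (W `&` chart_dom phi)) (f \o chart_inv phi).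

Definition msmooth f := msmooth_on setT f.

Definition msmooth_near (p : M) f :=
  exists W, [/\ open W, W p & msmooth_on W f].

(* Tangent vectors are the derivations at p of the functions smooth near p.
   Derivations are automatically local: if f = 0 on an open W containing p
   then f = f * \1_(~` W), and both factors are smooth near p and vanish
   at p. *)
Record tangent_vector (p : M) := TangentVector {
  tangent_fun :> (M -> R) -> R ;
  tangent_linear : forall (a : R) f g, msmooth_near p f -> msmooth_near p g ->
    tangent_fun (fun q => a * f q + g q) = a * tangent_fun f + tangent_fun g ;
  tangent_leibniz : forall f g, msmooth_near p f -> msmooth_near p g ->
    tangent_fun (fun q => f q * g q) = f p * tangent_fun g + g p * tangent_fun f
  }.

End manifold_theory.

Record frame (R : realType) (M : topologicalType) (E : M -> vectType R)
    (r : nat) := Frame {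
  frame_dom : set M ;
  frame_tuple :> forall p, r.-tuple (E p) ;
  frame_dom_open : open frame_dom ;
  frame_basis : forall p, frame_dom p -> basis_of fullv (frame_tuple p) }.

(* A rank r vector bundle is a family of vector spaces together with local
   bases of sections related by smooth transition matrices; these determine
   the local trivializations. *)
Record vector_bundle (R : realType) (n : nat) (M : manifold R n) (r : nat) :=
  VectorBundle {
  fibre :> M -> vectType R ;
  frames : set (frame fibre r) ;
  frames_cover : forall p, exists2 s, frames s & frame_dom s p ;
  frames_smooth : forall s t, frames s -> frames t -> forall a b,
    msmooth_on (frame_dom s `&` frame_dom t)
               (fun p => coord (t p) b (s p)`_a) }.

Section bundle_theory.
Context {R : realType} {n : nat} {M : manifold R n} {r : nat}.
Variable E : vector_bundle M r.

Definition section_comp (s : frame E r) (a : 'I_r) (u : forall p, E p)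
  (p : M) : R := coord (s p) a (u p).

Definition Sec : set (forall p, E p) := [set u | forall s, frames s ->
  forall a, msmooth_on (frame_dom s) (section_comp s a u)].

Definition dual_fibre (p : M) : vectType R := 'Hom(E p, R^o).

Record lie_algebroid := LieAlgebroid {
  anchor : forall p, E p -> tangent_vector p ;
  anchor_linear : forall p (a : R) (v w : E p) f, msmooth_near p f ->
    anchor (a *: v + w) f = a * anchor v f + anchor w f ;
  anchor_smooth : forall u f, Sec u -> msmooth f ->
    msmooth (fun p => anchor (u p) f) ;
  bracket : (forall p, E p) -> (forall p, E p) -> (forall p, E p) ;
  bracket_closed : forall u v, Sec u -> Sec v -> Sec (bracket u v) ;
  bracket_antisym : forall u v, Sec u -> Sec v -> forall p,
    bracket u v p = - bracket v u p ;
  bracket_linear : forall (a : R) u v w, Sec u -> Sec v -> Sec w -> forall p,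
    bracket u (fun q => a *: v q + w q) p = a *: bracket u v p + bracket u w p ;
  bracket_jacobi : forall u v w, Sec u -> Sec v -> Sec w -> forall p,
    bracket u (bracket v w) p + bracket v (bracket w u) p
      + bracket w (bracket u v) p = 0 ;
  bracket_leibniz : forall u v f, Sec u -> Sec v -> msmooth f -> forall p,
    bracket u (fun q => f q *: v q) p
      = anchor (u p) f *: v p + f p *: bracket u v p }.

Record metric := Metric {
  metric_fun :> forall p, E p -> E p -> R ;
  metric_linear : forall p (a : R) (v w z : E p),
    metric_fun (a *: v + w) z = a * metric_fun v z + metric_fun w z ;
  metric_sym : forall p (v w : E p), metric_fun v w = metric_fun w v ;
  metric_pos : forall p (v : E p), v != 0 -> 0 < metric_fun v v ;
  metric_smooth : forall s, frames s -> forall a b : 'I_r,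
    msmooth_on (frame_dom s) (fun p => metric_fun (s p)`_a (s p)`_b) }.

Section structure_functions.
Variables (L : lie_algebroid) (phi : chart R n M) (s : frame E r).

(* Q_a^A(p) *)
Definition anchor_coef (a : 'I_r) (A : 'I_n) (p : M) : R :=
  anchor L (s p)`_a (chart_coord phi A).

(* The bracket is defined on global sections only, so s_a is replaced by a
   global section with the same germ at p; one exists for p in the domain of s
   (multiply by a bump function), and the value of the bracket at p does not
   depend on the choice by the Leibniz rule. *)
Definition frame_ext (p : M) (a : 'I_r) : forall q, E q :=
  xget (fun=> 0) [set S | Sec S /\ \forall q \near p, S q = (s q)`_a].

(* Q_{ab}^c(p) *)
Definition bracket_coef (a b c : 'I_r) (p : M) : R :=
  coord (s p) c (bracket L (frame_ext p a) (frame_ext p b) p).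

End structure_functions.

(* Functions on the total spaces of E and of its dual, read in the coordinates
   (x^A, y^a) and (x^A, pi_a) induced by a chart phi and a frame s. *)
Section coordinates.
Variables (phi : chart R n M) (s : frame E r).

Definition vec_coord (p : M) (e : E p) : 'rV[R]_r :=
  \row_a coord (s p) a e.

Definition covec_coord (p : M) (pi : dual_fibre p) : 'rV[R]_r :=
  \row_a pi (s p)`_a.

Definition vec_of_coord (p : M) (y : 'rV[R]_r) : E p :=
  \sum_a y 0 a *: (s p)`_a.

Definition covec_of_coord (p : M) (z : 'rV[R]_r) : dual_fibre p :=
  \sum_a z 0 a *: linfun (coord (s p) a : E p -> R^o).

Definition local_expr (F : forall p, E p -> R) (x : 'rV[R]_n) (y : 'rV[R]_r)
  : R := F (chart_inv phi x) (vec_of_coord (chart_inv phi x) y).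

Definition dual_local_expr (F : forall p, dual_fibre p -> R)
  (x : 'rV[R]_n) (z : 'rV[R]_r) : R :=
  F (chart_inv phi x) (covec_of_coord (chart_inv phi x) z).

End coordinates.

Section tangent_lift.
Variables (L : lie_algebroid) (u : forall p, E p).
Variable F : forall p, E p -> R.

(* d_T(u)[F] at the point e of E, in the coordinates of phi and s *)
Definition tangent_lift_in (phi : chart R n M) (s : frame E r)
    (p : M) (e : E p) : R :=
  let x := phi p in
  let y := vec_coord s e in
  let Q a A := anchor_coef L phi s a A p in
  let C a b c := bracket_coef L s a b c p in
  let U a := section_comp s a u p in
  let dU A c := partial A (section_comp s c u \o chart_inv phi) x in
  let dFx A := partial A (local_expr phi s F ^~ y) x in
  let dFy c := partial c (local_expr phi s F x) y in
  \sum_a \sum_A U a * Q a A * dFx A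
  + \sum_c (\sum_a \sum_A y 0 a * Q a A * dU A c
            - \sum_a \sum_b y 0 a * U b * C b a c) * dFy c.

(* K = d_T(u)[F] as functions on E: the coordinate expression is independent of
   the coordinates, so it is required in all of them. *)
Definition is_tangent_lift (K : forall p, E p -> R) : Prop :=
  forall phi s, atlas phi -> frames s ->
  forall p (e : E p), chart_dom phi p -> frame_dom s p ->
  K p e = tangent_lift_in phi s e.

End tangent_lift.

Definition metric_quad (G : metric) (p : M) (y : E p) : R := G p y y.

Definition killing (L : lie_algebroid) (G : metric) (u : forall p, E p) : Prop :=
  is_tangent_lift L u (metric_quad G) (fun _ _ => 0).

Section poisson.
Variable L : lie_algebroid.
Variables F H : forall p, dual_fibre p -> R.

(* {F, H}_E at the point pi of the dual of E, in the coordinates of phi and s *)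
Definition poisson_in (phi : chart R n M) (s : frame E r)
    (p : M) (pi : dual_fibre p) : R :=
  let x := phi p in
  let z := covec_coord s pi in
  let Q a A := anchor_coef L phi s a A p in
  let C a b c := bracket_coef L s a b c p in
  let dx (K : forall p, dual_fibre p -> R) A :=
    partial A (dual_local_expr phi s K ^~ z) x in
  let dpi (K : forall p, dual_fibre p -> R) a :=
    partial a (dual_local_expr phi s K x) z in
  \sum_a \sum_A Q a A * (dpi F a * dx H A - dx F A * dpi H a)
  - \sum_a \sum_b \sum_c C b a c * z 0 c * dpi F a * dpi H b.

(* K = {F, H}_E as functions on the dual of E, again in all coordinates. *)
Definition is_poisson_bracket (K : forall p, dual_fibre p -> R) : Prop :=
  forall phi s, atlas phi -> frames s ->
  forall p (pi : dual_fibre p), chart_dom phi p -> frame_dom s p ->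
  K p pi = poisson_in phi s pi.

End poisson.

Definition linear_fun (u : forall p, E p) (p : M) (pi : dual_fibre p) : R :=
  pi (u p).

Section energy.
Variable G : metric.

Definition gram (k : nat) (p : M) (X : k.-tuple (E p)) : 'M[R]_k :=
  \matrix_(a, b) G p X`_a X`_b.

Definition energy_in (k : nat) (p : M) (X : k.-tuple (E p))
    (pi : dual_fibre p) : R :=
  2^-1 * \sum_a \sum_b invmx (gram X) a b * pi X`_b * pi X`_a.

(* The formula is evaluated in an arbitrary basis of each fibre; by energyE
   below, any local basis of sections gives the same function. *)
Definition energy (p : M) (pi : dual_fibre p) : R :=
  energy_in (vbasis (fullv : {vspace E p})) pi.

Lemma metric_suml k (p : M) (x : 'I_k -> R) (X : k.-tuple (E p)) (z : E p) :
  G p (\sum_a x a *: X`_a) z = \sum_a x a * G p X`_a z.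
Proof.
elim/big_rec2: _ => [|a y1 y2 _ IH]; last by rewrite metric_linear IH.
have := metric_linear G (- 1) (0 : E p) 0 z.
by rewrite scaler0 addr0 mulN1r addNr.
Qed.

Lemma metric_sumr k (p : M) (x : 'I_k -> R) (X : k.-tuple (E p)) (z : E p) :
  G p z (\sum_a x a *: X`_a) = \sum_a x a * G p z X`_a.
Proof.
by rewrite metric_sym metric_suml; under eq_bigr do rewrite metric_sym.
Qed.

Lemma gram_unit k (p : M) (X : k.-tuple (E p)) : free X -> gram X \in unitmx.
Proof.
move=> frX; rewrite -row_free_unit -kermx_eq0; apply/eqP/row_matrixP => i.
rewrite row0; set v := row i _.
have vG : v *m gram X = 0 by rewrite -row_mul mulmx_ker row0.
move: v vG => v vG.
pose w := \sum_a v 0 a *: X`_a.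
have ww : G p w w = 0.
  rewrite {2}/w metric_sumr big1 // => b _; rewrite metric_suml.
  transitivity (v 0 b * (v *m gram X) 0 b); last by rewrite vG mxE mulr0.
  by rewrite mxE; under [in RHS]eq_bigr do rewrite mxE.
have w0 : w = 0.
  by apply/eqP; apply: contraT => /(metric_pos G); rewrite ww ltxx.
by apply/rowP => a; rewrite [RHS]mxE; exact: (elimT freeP frX (v 0) w0 a).
Qed.

Lemma energy_in_basis k m (p : M) (X : k.-tuple (E p)) (Y : m.-tuple (E p))
    (pi : dual_fibre p) :
  basis_of fullv X -> basis_of fullv Y -> energy_in Y pi = energy_in X pi.
Proof.
move=> bX bY; have mk : m = k by rewrite -(size_basis bX) (size_basis bY).
subst m; pose row_of (Z : k.-tuple (E p)) : 'rV[R]_k := \row_a pi Z`_a.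
have main Z : energy_in Z pi =
    2^-1 * (row_of Z *m invmx (gram Z) *m (row_of Z)^T) 0 0.
  congr (_ * _); rewrite mxE exchange_big/=; apply: eq_bigr => b _.
  rewrite !mxE big_distrl/=; apply: eq_bigr => a _; rewrite !mxE.
  by rewrite mulrAC (mulrC (pi _)).
pose P : 'M[R]_k := \matrix_(i, j) coord Y j X`_i.
have XY (i : 'I_k) : X`_i = \sum_j P i j *: Y`_j.
  rewrite [LHS](coord_basis bY (memvf _)).
  by apply: eq_bigr => j _; rewrite mxE.
have rowXY : row_of X = row_of Y *m P^T.
  apply/rowP => i; rewrite !mxE XY linear_sum/=; apply: eq_bigr => j _.
  by rewrite linearZ/= !mxE mulrC.
have gramXY : gram X = P *m gram Y *m P^T.
  apply/matrixP => i j; rewrite mxE XY (XY j) metric_suml.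
  rewrite -mulmxA mxE; apply: eq_bigr => a _; congr (_ * _).
  rewrite metric_sumr mxE; apply: eq_bigr => b _.
  by rewrite !mxE mulrC.
have gX : gram X \in unitmx by apply/gram_unit/basis_free/bX.
have gY : gram Y \in unitmx by apply/gram_unit/basis_free/bY.
have uP : P \in unitmx.
  by move: gX; rewrite gramXY !unitmx_mul => /andP[/andP[]].
have invE : invmx (gram Y) = P^T *m invmx (gram X) *m P.
  have uPT : P^T \in unitmx by rewrite unitmx_tr.
  have eq1 : P^T *m invmx (gram X) *m P *m gram Y = 1%:M.
    rewrite -[LHS](mulmxK uPT) -!mulmxA (mulmxA P) (mulmxA _ P^T) -gramXY.
    by rewrite (mulmxA (invmx _)) mulVmx // mul1mx mulmxV.
  by rewrite -[LHS]mul1mx -eq1 mulmxK.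
by rewrite !main invE rowXY trmx_mul trmxK !mulmxA.
Qed.

Lemma energyE k (p : M) (X : k.-tuple (E p)) (pi : dual_fibre p) :
  basis_of fullv X -> energy pi = energy_in X pi.
Proof. by move=> bX; apply: energy_in_basis (vbasisP _). Qed.

End energy.

End bundle_theory.

(* Main.v *)
(* In a chart and a frame, let z = y g be the covector dual to y, where g is the
   Gram matrix. From d(g^-1) = - g^-1 dg g^-1 and the antisymmetry of Q_{ab}^c
   one gets {u, H}_E(z) = - 1/2 d_T(u)[G](y) pointwise; since y |-> y g is a
   bijection of the fibres, one side vanishes iff the other does. *)
Require Import Defs.
From mathcomp Require Import all_boot all_order all_algebra.
From mathcomp Require Import all_classical all_reals all_analysis.
From mathcomp Require Import ring.

Set Implicit Arguments.
Unset Strict Implicit.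
Unset Printing Implicit Defensive.

Import Order.TTheory GRing.Theory Num.Theory.
Import numFieldNormedType.Exports.

Local Open Scope classical_set_scope.
Local Open Scope ring_scope.

(** * Directional derivatives of matrix-valued functions *)

Section matrix_derivative.
Context {R : realType} {V : normedModType R}.
Implicit Types (x v : V).

(** Entrywise, so that scalar derivative rules apply and quadratic forms can be read off as entry
    [0 0] of a matrix product. *)
Definition is_derive_mx m n x v (N : V -> 'M[R]_(m, n)) (dN : 'M[R]_(m, n)) :=
  forall i j, is_derive x v (fun t => N t i j) (dN i j).

Lemma is_derive_mx_cst m n x v (N : 'M[R]_(m, n)) :
  is_derive_mx x v (fun=> N) 0.
Proof. by move=> i j; rewrite mxE; exact: is_derive_cst. Qed.

Lemma is_derive_mx_tr m n x v (N : V -> 'M[R]_(m, n)) dN :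
  is_derive_mx x v N dN -> is_derive_mx x v (fun t => (N t)^T) dN^T.
Proof.
move=> dNP i j; rewrite mxE.
rewrite (_ : (fun t => _) = (fun t => N t j i)) //.
by apply/funext => t; rewrite mxE.
Qed.

Lemma is_derive_mxM m n p x v (N : V -> 'M[R]_(m, n)) dN
    (P : V -> 'M[R]_(n, p)) dP :
  is_derive_mx x v N dN -> is_derive_mx x v P dP ->
  is_derive_mx x v (fun t => N t *m P t) (dN *m P x + N x *m dP).
Proof.
move=> dNP dPP i j.
rewrite (_ : (fun t => _) =
    \sum_k ((fun t => N t i k) * (fun t => P t k j))); last first.
  by apply/funext => t; rewrite mxE fct_sumE.
apply: is_derive_eq.
  by apply: is_derive_sum => k; apply: is_deriveM; [exact: dNP|exact: dPP].
rewrite !mxE -big_split/=; apply: eq_bigr => k _.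
by rewrite addrC [dN i k * _]mulrC.
Qed.

Lemma derivable_prod (I : Type) (s : seq I) (F : I -> V -> R) x v :
  (forall i, derivable (F i) x v) ->
  derivable (fun t => \prod_(i <- s) F i t) x v.
Proof.
move=> dF; elim: s => [|i s IH].
  rewrite (_ : (fun t => _) = cst 1); first exact: derivable_cst.
  by apply/funext => t; rewrite big_nil.
rewrite (_ : (fun t => _) = F i * (fun t => \prod_(i <- s) F i t)).
  exact: derivableM.
by apply/funext => t; rewrite big_cons.
Qed.

Lemma derivable_bigsum (I : Type) (s : seq I) (F : I -> V -> R) x v :
  (forall i, derivable (F i) x v) ->
  derivable (fun t => \sum_(i <- s) F i t) x v.
Proof.
move=> dF; elim: s => [|i s IH].
  rewrite (_ : (fun t => _) = cst 0); first exact: derivable_cst.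
  by apply/funext => t; rewrite big_nil.
rewrite (_ : (fun t => _) = F i + (fun t => \sum_(i <- s) F i t)).
  exact: derivableD.
by apply/funext => t; rewrite big_cons.
Qed.

(** The Leibniz formula makes the determinant a polynomial in the entries. *)
Lemma derivable_det n (N : V -> 'M[R]_n) x v :
  (forall i j, derivable (fun t => N t i j) x v) ->
  derivable (fun t => \det (N t)) x v.
Proof.
move=> dN; rewrite /determinant; apply: derivable_bigsum => s.
apply: (derivableM (f := cst _)); first exact: derivable_cst.
by apply: derivable_prod => i; exact: dN.
Qed.

Lemma derivable_adj n (N : V -> 'M[R]_n) x v :
  (forall i j, derivable (fun t => N t i j) x v) ->
  forall i j, derivable (fun t => (\adj (N t)) i j) x v.
Proof.
move=> dN i j.
rewrite (_ : (fun t => _) = cst ((-1) ^+ (j + i)) *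
    (fun t => \det (row' j (col' i (N t))))); last first.
  by apply/funext => t; rewrite mxE.
apply: derivableM; first exact: derivable_cst.
apply: derivable_det => k l.
rewrite (_ : (fun t => _) = (fun t => N t (lift j k) (lift i l))) //.
by apply/funext => t; rewrite !mxE.
Qed.

(** Cramer's formula gives derivability of the inverse; its derivative is then forced by the product
    rule. *)
Lemma is_derive_mx_inv n (N : V -> 'M[R]_n) dN x v :
  is_derive_mx x v N dN -> (\near x, N x \in unitmx) ->
  is_derive_mx x v (fun t => invmx (N t)) (- (invmx (N x) *m dN *m invmx (N x))).
Proof.
move=> dNP uN.
have uNx : N x \in unitmx by exact: nbhs_singleton uN.
have derN i j : derivable (fun t => N t i j) x v by case: (dNP i j).
pose D : 'M[R]_n := \matrix_(i, j) 'D_v (fun t => invmx (N t) i j) x.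
have DP : is_derive_mx x v (fun t => invmx (N t)) D.
  move=> i j; rewrite mxE; apply: derivableP.
  (* [invmx] equals the adjugate over the determinant only at invertible matrices and returns its
     argument elsewhere, so invertibility is needed near [x]. *)
  apply: (@near_eq_derivable _ _ _
    ((fun t => (\det (N t))^-1) * (fun t => (\adj (N t)) i j))).
    by near=> t; rewrite /invmx (near uN t _) // mxE.
  apply: derivableM; last exact: derivable_adj.
  apply: derivableV; last exact: derivable_det.
  by rewrite -unitfE -unitmxE.
(* D is found by differentiating N *m invmx N = 1. *)
suff -> : - (invmx (N x) *m dN *m invmx (N x)) = D by [].
have key : dN *m invmx (N x) + N x *m D = 0.
  apply/matrixP => i j; rewrite [RHS]mxE.
  have [_ <-] := is_derive_mxM dNP DP i j.
  rewrite (@near_eq_derive _ _ _ _ (cst ((1%:M : 'M[R]_n) i j))) ?derive_cst //.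
  by near=> t; rewrite mulmxV ?(near uN t _).
apply/eqP; rewrite eq_sym -addr_eq0 -mulmxA -[D](mulKmx uNx) -mulmxDr.
by rewrite addrC key mulmx0.
Unshelve. all: by end_near. Qed.

End matrix_derivative.

Lemma mulmx_delta_tr (R : realType) (m : nat) (N : 'rV[R]_m) c :
  (N *m (delta_mx 0 c : 'rV[R]_m)^T) 0 0 = N 0 c.
Proof. by rewrite trmx_delta -colE mxE. Qed.

Lemma is_derive_mx_id (R : realType) (m : nat) (y v : 'rV[R]_m) :
  is_derive_mx y v id v.
Proof.
move=> i j; have dy : derivable id y v by exact: derivable_id.
have := derive_mx dy; rewrite derive_id => {2}->; rewrite mxE.
by apply: derivableP; exact: (derivable_mxP _ _ _).1.
Qed.

Lemma is_derive_quadratic (R : realType) (m : nat) (B : 'M[R]_m)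
    (y : 'rV[R]_m) c : B^T = B ->
  is_derive y (delta_mx 0 c : 'rV[R]_m)
    (fun y : 'rV[R]_m => (y *m B *m y^T) 0 0) (2 * (y *m B) 0 c).
Proof.
move=> Bsym; have dy := is_derive_mx_id y (delta_mx 0 c).
have dq := is_derive_mxM (is_derive_mxM dy (is_derive_mx_cst _ _ B))
  (is_derive_mx_tr dy) 0 0.
apply: (is_derive_eq dq); rewrite mulmx0 addr0 mxE mulmx_delta_tr.
(* The first product-rule term is a 1 by 1 matrix, hence equal to its transpose; symmetry of [B]
   makes it the second term. *)
rewrite -[in X in X + _](trmxK (delta_mx 0 c *m B *m y^T)) mxE.
by rewrite !trmx_mul trmxK Bsym mulmxA mulmx_delta_tr mulr2n mulrDl !mul1r.
Qed.


(** * Smooth functions read in a chart *)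

Section smooth_local.
Context {R : realType} {n : nat} {M : manifold R n}.
Variables (phi : chart R n M) (p : M).
Hypotheses (phiM : atlas phi) (phip : chart_dom phi p).

Lemma near_chart_inv (W : set M) :
  open W -> W p -> \forall x \near phi p, W (chart_inv phi x).
Proof.
move=> oW Wp; apply: (chart_inv_continuous (c := phi)); first by exists p.
by rewrite chart_mapK //; apply: open_nbhs_nbhs.
Qed.

Lemma msmooth_on_differentiable (W : set M) (f : M -> R) :
  msmooth_on W f -> W p -> differentiable (f \o chart_inv phi) (phi p).
Proof.
by move=> /(_ _ phiM 1%N)[+ _] Wp; apply; exists p.
Qed.

End smooth_local.

(** * Frame coordinates on the bundle and on its dual *)

Section bundle_local.
Context {R : realType} {n r : nat} {M : manifold R n} {E : vector_bundle M r}.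

Lemma Sec0 : Sec (fun q => 0 : E q).
Proof.
move=> s _ a phi _ k.
rewrite (_ : _ \o _ = cst 0); last first.
  by apply/funext => x; rewrite /= /section_comp linear0.
elim: k => [|k IH] /=; first by move=> x _; exact: cst_continuous.
split=> // i; rewrite (_ : partial i (cst 0) = cst 0) //.
by apply/funext => x; rewrite /partial derive_cst.
Qed.

(* When s_a has no global extension, frame_ext takes the default value 0 of
   xget, which is a section too. *)
Lemma Sec_frame_ext (s : frame E r) p a : Sec (frame_ext s p a).
Proof. by rewrite /frame_ext; case: xgetP => [S _ []|_] //; exact: Sec0. Qed.

(** Valid at every [p], even off the domain of [s], because [frame_ext] is always a global
    section. *)
Lemma bracket_coef_antisym (L : lie_algebroid E) (s : frame E r) a b c p :
  bracket_coef L s a b c p = - bracket_coef L s b a c p.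
Proof.
rewrite /bracket_coef bracket_antisym ?linearN //; exact: Sec_frame_ext.
Qed.

Lemma covec_of_coordE (s : frame E r) p z (v : E p) :
  covec_of_coord s p z v = \sum_a z 0 a * coord (s p) a v.
Proof.
rewrite /covec_of_coord sum_lfunE; apply: eq_bigr => a _.
by rewrite scale_lfunE lfunE.
Qed.

(** Coordinate functionals are dual to the frame. Every row vector is thus the coordinate vector of
    some covector, which is how the theorem produces its witness. *)
Lemma covec_of_coordK (s : frame E r) p :
  frame_dom s p -> cancel (covec_of_coord s p) (covec_coord s (p := p)).
Proof.
move=> sp z; apply/rowP => a; rewrite mxE covec_of_coordE (bigD1 a) //=.
have fs := basis_free (frame_basis sp).
rewrite coord_free // eqxx mulr1 big1 ?addr0 // => b ba.
by rewrite coord_free // eq_sym (negbTE ba) mulr0.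
Qed.

Lemma vec_of_coordK (s : frame E r) p :
  frame_dom s p -> cancel (vec_of_coord s p) (vec_coord s (p := p)).
Proof.
move=> sp y; apply/rowP => a; rewrite mxE.
exact/coord_sum_free/(basis_free (frame_basis sp)).
Qed.

Variable G : metric E.

Lemma gram_sym k p (X : k.-tuple (E p)) : (gram G X)^T = gram G X.
Proof. by apply/matrixP => i j; rewrite !mxE Defs.metric_sym. Qed.

(** Linearity and symmetry of the metric give this for any tuple, basis or not, so it may be
    rewritten under a derivative in [x] without localizing. *)
Lemma metric_quad_coord (s : frame E r) p y :
  metric_quad G (vec_of_coord s p y) = (y *m gram G (s p) *m y^T) 0 0.
Proof.
rewrite /metric_quad /vec_of_coord metric_sumr mxE.
apply: eq_bigr => b _; rewrite metric_suml !mxE mulrC; congr (_ * _).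
by apply: eq_bigr => a _; rewrite mxE.
Qed.

(** Basis independence of the energy allows the frame to replace the arbitrary basis of its
    definition, but only where the frame is a basis. *)
Lemma energy_coord (s : frame E r) p z : frame_dom s p ->
  energy G (covec_of_coord s p z) =
  2^-1 * (z *m invmx (gram G (s p)) *m z^T) 0 0.
Proof.
move=> sp; rewrite (energyE _ _ (frame_basis sp)) /energy_in; congr (_ * _).
have zE (a : 'I_r) : covec_of_coord s p z (s p)`_a = z 0 a.
  by rewrite -[in RHS](covec_of_coordK sp z) mxE.
rewrite mxE exchange_big /=; apply: eq_bigr => b _.
rewrite !mxE big_distrl /=; apply: eq_bigr => a _.
by rewrite !zE; ring.
Qed.

End bundle_local.


(** * Partial derivatives in coordinates, and comparison of the bracket with the tangent lift *)

Section coordinate_formulas.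
Context {R : realType} {n r : nat} {M : manifold R n} {E : vector_bundle M r}.
Variables (L : lie_algebroid E) (G : metric E) (u : forall p : M, E p).
Hypothesis uS : Sec u.
Variables (phi : chart R n M) (s : frame E r) (p : M).
Hypotheses (phiM : atlas phi) (sE : frames s).
Hypotheses (phip : chart_dom phi p) (sp : frame_dom s p).

Let g := gram G (s p).
Let dg A : 'M[R]_r := \matrix_(a, b)
  partial A (fun x => gram G (s (chart_inv phi x)) a b) (phi p).
Let Q a A := anchor_coef L phi s a A p.
Let C a b c := bracket_coef L s a b c p.
Let U a := section_comp s a u p.
Let dU A c := partial A (section_comp s c u \o chart_inv phi) (phi p).

Let is_derive_gram A : is_derive_mx (phi p) (delta_mx 0 A)
  (fun x => gram G (s (chart_inv phi x))) (dg A).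
Proof.
move=> a b; rewrite mxE; apply: derivableP; apply: diff_derivable.
rewrite (_ : (fun x => _) =
    (fun q => G q (s q)`_a (s q)`_b) \o chart_inv phi); last first.
  by apply/funext => x; rewrite mxE.
by apply: (msmooth_on_differentiable phiM phip) sp; exact: metric_smooth.
Qed.

Let gramE : gram G (s (chart_inv phi (phi p))) = g.
Proof. by rewrite chart_mapK. Qed.

Lemma partial_metric_quad_base A y :
  partial A ((local_expr phi s (metric_quad G))^~ y) (phi p) =
  (y *m dg A *m y^T) 0 0.
Proof.
rewrite (_ : _^~ y = fun x =>
    (y *m gram G (s (chart_inv phi x)) *m y^T) 0 0); last first.
  by apply/funext => x; exact: metric_quad_coord.
rewrite /partial; have [_ ->] := is_derive_mxM (is_derive_mxM (is_derive_mx_cst _ _ y)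
  (is_derive_gram A)) (is_derive_mx_cst _ _ y^T) 0 0.
by rewrite mul0mx add0r mulmx0 addr0.
Qed.

Lemma partial_metric_quad_fibre c y :
  partial c (local_expr phi s (metric_quad G) (phi p)) y =
  2 * (y *m g) 0 c.
Proof.
rewrite (_ : local_expr _ _ _ _ = fun y => (y *m g *m y^T) 0 0); last first.
  by apply/funext => z; rewrite -gramE; exact: metric_quad_coord.
by rewrite /partial; have [_ ->] := is_derive_quadratic y c (gram_sym G (s p)).
Qed.

Lemma partial_linear_fun_base A z :
  partial A ((dual_local_expr phi s (linear_fun u))^~ z) (phi p) =
  \sum_c dU A c * z 0 c.
Proof.
have dUP c : is_derive (phi p) (delta_mx 0 A)
    (z 0 c \*: (section_comp s c u \o chart_inv phi)) (z 0 c *: dU A c).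
  apply: is_deriveZ; apply: derivableP; apply: diff_derivable.
  by apply: (msmooth_on_differentiable phiM phip) sp; exact: uS.
rewrite (_ : _^~ z = \sum_c (z 0 c \*: (section_comp s c u \o chart_inv phi))).
  rewrite /partial; have [_ ->] := is_derive_sum dUP.
  by apply: eq_bigr => c _; rewrite mulrC.
apply/funext => x; rewrite fct_sumE; exact: covec_of_coordE.
Qed.

Lemma partial_linear_fun_fibre a z :
  partial a (dual_local_expr phi s (linear_fun u) (phi p)) z = U a.
Proof.
rewrite (_ : dual_local_expr _ _ _ _ =
    fun z => (z *m (\row_c U c)^T) 0 0); last first.
  apply/funext => w; rewrite /dual_local_expr /linear_fun chart_mapK //.
  by rewrite covec_of_coordE mxE; apply: eq_bigr => c _; rewrite !mxE.
rewrite /partial; have [_ ->] := is_derive_mxM (is_derive_mx_id z (delta_mx 0 a))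
  (is_derive_mx_cst _ _ (\row_c U c)^T) 0 0.
by rewrite mulmx0 addr0 -rowE !mxE.
Qed.

(** Differentiating the inverse Gram matrix gives the minus sign and two factors [invmx g]; by
    symmetry these turn both copies of [z] into [z *m invmx g]. *)
Lemma partial_energy_base A z :
  partial A ((dual_local_expr phi s (energy G))^~ z) (phi p) =
  - 2^-1 * (z *m invmx g *m dg A *m (z *m invmx g)^T) 0 0.
Proof.
have near_s := near_chart_inv phip (@frame_dom_open _ _ _ _ s) sp.
have near_unit :
    \forall x \near phi p, gram G (s (chart_inv phi x)) \in unitmx.
  near=> x; apply/gram_unit/basis_free/frame_basis.
  by near: x.
have [dz dzE] := is_derive_mxM (is_derive_mxM (is_derive_mx_cst _ _ z)
  (is_derive_mx_inv (is_derive_gram A) near_unit))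
  (is_derive_mx_cst _ _ z^T) 0 0.
(* [energy_coord] holds on the frame domain only, so the function is replaced just near [phi p]. *)
rewrite /partial (near_eq_derive _ (g := 2^-1 \*: (fun x =>
    (z *m invmx (gram G (s (chart_inv phi x))) *m z^T) 0 0))); last first.
  near=> x; apply: energy_coord; by near: x.
rewrite deriveZ // dzE gramE mul0mx add0r mulmx0 addr0.
rewrite trmx_mul trmx_inv gram_sym mulmxN mulNmx mxE scalerN mulNr.
by rewrite !mulmxA.
Unshelve. all: by end_near. Qed.

(** This is the inverse Legendre map: the fibre derivative of the energy is the vector dual to
    [z]. *)
Lemma partial_energy_fibre b z :
  partial b (dual_local_expr phi s (energy G) (phi p)) z =
  (z *m invmx g) 0 b.
Proof.
rewrite (_ : dual_local_expr _ _ _ _ =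
    2^-1 \*: (fun z => (z *m invmx g *m z^T) 0 0)); last first.
  apply/funext => w; rewrite /= -gramE; apply: energy_coord.
  by rewrite chart_mapK.
have ginv_sym : (invmx g)^T = invmx g by rewrite trmx_inv gram_sym.
have [dz dzE] := is_derive_quadratic z b ginv_sym.
by rewrite /partial deriveZ // dzE /GRing.scale /= mulKf // pnatr_eq0.
Qed.

Lemma poisson_energyE (e : E p) (pi : dual_fibre E p) :
  covec_coord s pi = vec_coord s e *m g ->
  poisson_in L (linear_fun u) (energy G) phi s pi =
  - 2^-1 * tangent_lift_in L u (metric_quad G) phi s e.
Proof.
move=> zE; rewrite /poisson_in /tangent_lift_in.
set z := covec_coord s pi in zE *; set y := vec_coord s e in zE *.
have yE : z *m invmx g = y.
  by rewrite zE mulmxK //; apply/gram_unit/basis_free/frame_basis.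
pose q A := (y *m dg A *m y^T) 0 0.
(* [S1] collects the base derivatives of the metric, [S2] the derivatives of [u], [S3] the structure
   functions of the bracket. Both sides of the claim are combinations of these three sums. *)
pose S1 := \sum_a \sum_A U a * Q a A * q A.
pose S2 := \sum_a \sum_A \sum_c y 0 a * Q a A * dU A c * z 0 c.
pose S3 := \sum_a \sum_b \sum_c y 0 a * U b * C b a c * z 0 c.
transitivity (- 2^-1 * S1 - S2 + S3).
  congr (_ + _).
    rewrite mulr_sumr -sumrB; apply: eq_bigr => a _.
    rewrite mulr_sumr -sumrB; apply: eq_bigr => A _.
    rewrite partial_linear_fun_fibre partial_linear_fun_base.
    rewrite partial_energy_base partial_energy_fibre yE -/(q A) -/(Q a A).
    rewrite mulrBr; congr (_ - _); first by ring.
    by rewrite mulr_suml mulr_sumr; apply: eq_bigr => c _; ring.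
  (* Exchanging [a] and [b] puts [y] on the index [a] and [U] on [b], as in [S3]; antisymmetry of
     the structure functions then flips the sign. *)
  rewrite exchange_big -sumrN; apply: eq_bigr => a _.
  rewrite -sumrN; apply: eq_bigr => b _; rewrite -sumrN; apply: eq_bigr => c _.
  rewrite partial_linear_fun_fibre partial_energy_fibre yE.
  by rewrite bracket_coef_antisym -/(C b a c); ring.
have -> : - 2^-1 * S1 - S2 + S3 = - 2^-1 * (S1 + 2 * (S2 - S3)) by field.
congr (_ * (_ + _)).
  apply: eq_bigr => a _; apply: eq_bigr => A _.
  by rewrite partial_metric_quad_base.
(* The sum over [c] is moved outermost, as in the tangent lift, where it pairs with the fibre
   derivative of the metric, equal to [2 * z 0 c]. *)
have -> : S2 = \sum_c \sum_a \sum_A y 0 a * Q a A * dU A c * z 0 c.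
  by rewrite exchange_big; apply: eq_bigr => a _; rewrite exchange_big.
have -> : S3 = \sum_c \sum_a \sum_b y 0 a * U b * C b a c * z 0 c.
  by rewrite exchange_big; apply: eq_bigr => a _; rewrite exchange_big.
rewrite -sumrB mulr_sumr; apply: eq_bigr => c _.
rewrite partial_metric_quad_fibre -zE mulrCA; congr (_ * _).
rewrite mulrBl; congr (_ - _); rewrite mulr_suml; apply: eq_bigr => a _;
  by rewrite mulr_suml.
Qed.

End coordinate_formulas.

Theorem theorem3p3 (R : realType) (n r : nat) (M : manifold R n)
    (E : vector_bundle M r) (L : lie_algebroid E) (G : metric E)
    (u : forall p : M, E p) (hu : Sec u) :
  killing L G u <->
  is_poisson_bracket L (linear_fun u) (energy G) (fun _ _ => 0).
Proof.
split=> zero phi s phiM sE p.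
  move=> pi phip sp.
  (* The vector metrically dual to [pi]: its coordinates [y] solve [y *m g = z]. *)
  pose e := vec_of_coord s p (covec_coord s pi *m invmx (gram G (s p))).
  rewrite (poisson_energyE L hu phiM sE phip sp (e := e)).
    by rewrite -zero // mulr0.
  rewrite vec_of_coordK // mulmxKV //.
  exact/gram_unit/basis_free/frame_basis.
move=> e phip sp.
(* Conversely, the covector obtained from [e] by lowering its index with the metric. *)
pose pi := covec_of_coord s p (vec_coord s e *m gram G (s p)).
have := zero phi s phiM sE p pi phip sp.
rewrite (poisson_energyE L hu phiM sE phip sp (e := e)).
  (* The factor [- 2^-1] is nonzero, so the tangent lift itself vanishes. *)
  by move/esym/eqP; rewrite mulf_eq0 oppr_eq0 invr_eq0 pnatr_eq0 => /eqP.
exact: covec_of_coordK.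
Qed.
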